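(* For all integers $n\ge 1$ and $k\ge 0$, $$\sum_{m=n}^{2n-1}(-1)^{m-n}\binom{m-n}{k}N_{n,m}=(-1)^k d_{n,k},$$ where $N_{n,m}$ is the number of connected noncrossing graphs with $n+1$ vertices and $m$ edges, and $d_{n,k}$ is the number of noncrossing trees with $n$ edges and $k$ descents.
   Context: A noncrossing graph with $n+1$ vertices is a simple graph on the vertex set $\{1,\dots,n+1\}$, the vertices placed in counterclockwise order on a circle, whose edges are chords drawn inside the circle that pairwise do not cross. A noncrossing tree with $n$ edges is a connected noncrossing graph on $n+1$ vertices that is a tree; it is rooted at vertex $1$. A descent of a noncrossing tree is an edge $(i,j)$ with $i>j$ such that $i$ lies on the path from the root $1$ to $j$ (i.e. $i$ is the parent of $j$). *)

(* Defs.v *)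
From mathcomp Require Import all_boot all_order all_algebra.

Set Implicit Arguments.
Unset Strict Implicit.
Unset Printing Implicit Defensive.

Section Noncrossing.
Variable n : nat.

(* The vertices 1, ..., n+1 are represented by 0, ..., n : 'I_n.+1, in the    *)
(* same circular order; the root 1 is ord0. A graph is its set of edges.      *)
Implicit Types (E : {set {set 'I_n.+1}}) (i j x y : 'I_n.+1).

Definition simple_graph E : bool := [forall e in E, #|e| == 2].

Definition adj E : rel 'I_n.+1 := fun x y => [set x; y] \in E.

(* Two chords of the circle cross iff their endpoints are four distinct       *)
(* points that alternate around the circle.                                   *)
Definition noncrossing E : bool :=
  [forall a : 'I_n.+1, forall b : 'I_n.+1, forall c : 'I_n.+1,
   forall d : 'I_n.+1, [&& a < b, b < c & c < d] ==> ~~ (adj E a c && adj E b d)].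

Definition connected E : bool :=
  [forall x : 'I_n.+1, forall y : 'I_n.+1, connect (adj E) x y].

(* A duplicate-free sequence of vertices has length at most n+1, so bounding  *)
(* the length only serves to make the quantification finite: see acyclicP.    *)
Definition acyclic E : bool :=
  [forall k : 'I_n.+2, forall c : k.-tuple 'I_n.+1,
     ucycleb (adj E) c ==> (size c <= 2)].

Definition connected_noncrossing_graph E : bool :=
  [&& simple_graph E, noncrossing E & connected E].

Definition noncrossing_tree E : bool :=
  connected_noncrossing_graph E && acyclic E.

(* i lies on a duplicate-free path from the root to j (this path is unique in *)
(* a tree); as above, the length bound is no restriction: see on_root_pathP.  *)
Definition on_root_path E i j : bool :=
  [exists k : 'I_n.+1, exists p : k.-tuple 'I_n.+1,
     [&& path (adj E) ord0 p, uniq (ord0 :: p), last ord0 p == j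
       & i \in ord0 :: p]].

Definition descents E : {set 'I_n.+1 * 'I_n.+1} :=
  [set ij : 'I_n.+1 * 'I_n.+1 |
    [&& adj E ij.1 ij.2, ij.2 < ij.1 & on_root_path E ij.1 ij.2]].

Lemma acyclicP E :
  reflect (forall c : seq 'I_n.+1, cycle (adj E) c -> uniq c -> size c <= 2)
          (acyclic E).
Proof.
apply: (iffP forallP) => [H c cc uc | H k].
  have sc : size c < n.+2.
    by rewrite ltnS -(card_uniqP uc) -[X in _ <= X]card_ord max_card.
  have /forallP/(_ (in_tuple c)) := H (Ordinal sc).
  by rewrite /ucycleb /= cc uc.
by apply/forallP => c; apply/implyP => /andP[cc uc]; apply: H.
Qed.

Lemma on_root_pathP E i j :
  reflect (exists p : seq 'I_n.+1,
             [/\ path (adj E) ord0 p, uniq (ord0 :: p), last ord0 p = j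
               & i \in ord0 :: p])
          (on_root_path E i j).
Proof.
apply: (iffP existsP) => [[k /existsP[p /and4P[pp up /eqP lp ip]]] | [p [pp up lp ip]]].
  by exists p; split.
have sp : size p < n.+1.
  by rewrite -[(_ < _)%N]/(size (ord0 :: p) <= n.+1) -(card_uniqP up)
             -[X in _ <= X]card_ord max_card.
exists (Ordinal sp); apply/existsP; exists (in_tuple p).
by apply/and4P; split => //; apply/eqP.
Qed.

End Noncrossing.

Definition nb_connected_noncrossing_graphs (n m : nat) : nat :=
  #|[set E : {set {set 'I_n.+1}} | connected_noncrossing_graph E && (#|E| == m)]|.

Definition nb_noncrossing_trees_descents (n k : nat) : nat :=
  #|[set E : {set {set 'I_n.+1}} | noncrossing_tree E && (#|descents E| == k)]|.

(* Main.v *)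
(* Order edges lexicographically by (smaller endpoint, larger endpoint). Deleting
   from a connected noncrossing graph E every edge that is the least one of some
   cycle leaves a noncrossing spanning tree T = core E. Conversely, the graphs
   with core T are exactly the unions of T with an arbitrary subset of chords T,
   the active chords that cross no edge of T. These chords are pairwise
   noncrossing, and sending such a chord {x, j}, x < j, to j is a bijection onto
   the vertices smaller than their parent: x must be the largest vertex for which
   {x, j} is active, and an active {x, j} exists iff j lies below its parent.
   So the fiber over T is a Boolean interval of rank the number d of descents of
   T, and its contribution is the sum over s of (-1)^s C(s,k) C(d,s), which is
   (-1)^k if d = k and 0 otherwise. *)
Require Import Defs.
From mathcomp Require Import all_boot all_order all_algebra.
From mathcomp Require Import zify.

Set Implicit Arguments.
Unset Strict Implicit.
Unset Printing Implicit Defensive.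

(** * Walks that avoid a vertex *)

Section Avoid.
Variable T : finType.
Implicit Types (e : rel T) (P : pred T) (v x y z : T).

Definition avoid v e : rel T := fun x y => [&& x != v, y != v & e x y].

Lemma avoid_sym v e : symmetric e -> symmetric (avoid v e).
Proof. by move=> se x y; rewrite /avoid se andbCA. Qed.

Lemma path_avoid v e x p :
  path (avoid v e) x p -> path e x p /\ v \notin p.
Proof.
elim: p x => //= y p IH x /andP[/and3P[_ yv exy] /IH[ep vp]].
by rewrite exy ep inE negb_or eq_sym yv.
Qed.

Lemma avoid_path v e x p :
  path e x p -> v \notin x :: p -> path (avoid v e) x p.
Proof.
elim: p x => //= y p IH x /andP[exy ep]; rewrite inE negb_or => /andP[vx vp].
rewrite IH // andbT /avoid exy andbT eq_sym vx.
by move: vp; rewrite inE negb_or eq_sym => /andP[].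
Qed.

Lemma connect_invariant e P x y :
  (forall u w, e u w -> P u -> P w) -> connect e x y -> P x -> P y.
Proof.
move=> H /connectP[p ep ->]; elim: p x ep => //= z p IH x /andP[exz ep] Px.
exact: IH ep (H _ _ exz Px).
Qed.

(** Cut the walk at its first arrival at [y]. *)
Lemma connect_last_step e x y :
  connect e x y -> x != y -> exists2 z, connect (avoid y e) x z & e z y.
Proof.
case/connectP=> p; elim: p x => [|z p IH] x /=.
  by move=> _ ->; rewrite eqxx.
case/andP=> exz ep lp xy; have [zy|zy] := eqVneq z y.
  by exists x => //; rewrite -zy.
have [w zw ewy] := IH z ep lp zy; exists w => //.
by apply: connect_trans zw; apply: connect1; rewrite /avoid xy zy.
Qed.

(** Every vertex met on a walk from [x] is reachable from [x], so the walk cannot meet [z]. *)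
Lemma connect_avoid_unreachable e x y z :
  connect e x y -> ~~ connect e x z -> connect (avoid z e) x y.
Proof.
move=> cxy nxz.
suff /andP[] : connect e x y && connect (avoid z e) x y by [].
apply: (connect_invariant (P := fun w => connect e x w && connect (avoid z e) x w)
  _ cxy); last by rewrite !connect0.
move=> u w euw /andP[xu axu]; have xw := connect_trans xu (connect1 euw).
rewrite xw; apply: connect_trans axu (connect1 _).
by rewrite /avoid euw andbT; apply/andP; split; apply: contraNneq nxz => <-.
Qed.

End Avoid.

(** * Edges and crossings *)

Section Graphs.
Variable n : nat.
Notation V := 'I_n.+1.
Implicit Types (E T S : {set {set V}}) (a b c d i j u v w x y z : V).

Lemma pair_lt_inj a b c d :
  a < b -> c < d -> [set a; b] = [set c; d] -> a = c /\ b = d.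
Proof.
move=> ab cd eq.
have: a \in [set c; d] by rewrite -eq set21.
have: b \in [set c; d] by rewrite -eq set22.
have: c \in [set a; b] by rewrite eq set21.
rewrite !inE.
by do 3![case/orP=> /eqP ?]; subst; split=> //; apply: val_inj => /=; lia.
Qed.

Lemma ord_lt_neq a b : a < b -> a != b.
Proof. by rewrite -val_eqE neq_ltn => ->. Qed.

Lemma adjC E : symmetric (adj E).
Proof. by move=> x y; rewrite /adj setUC. Qed.

Lemma adjS E T x y : T \subset E -> adj T x y -> adj E x y.
Proof. by move=> /subsetP; apply. Qed.

Lemma adj_neq E x y : simple_graph E -> adj E x y -> x != y.
Proof. by move=> /forall_inP sE /sE; rewrite cards2; case: (x != y). Qed.

Lemma simple_graph_edge E e :
  simple_graph E -> e \in E -> exists a b, a < b /\ e = [set a; b].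
Proof.
move=> /forall_inP sE /sE /cards2P[a [b [ab ->]]].
have [lt|lt|/val_inj eq] := ltngtP a b; last by rewrite eq eqxx in ab.
  by exists a, b.
by exists b, a; rewrite setUC.
Qed.

Lemma noncrossingP E :
  reflect (forall a b c d, a < b -> b < c -> c < d ->
             adj E a c -> adj E b d -> False)
          (noncrossing E).
Proof.
apply: (iffP idP) => [H a b c d ab bc cd ac bd | H].
  move/forallP/(_ a)/forallP/(_ b)/forallP/(_ c)/forallP/(_ d): H.
  by rewrite ab bc cd ac bd.
apply/forallP=> a; apply/forallP=> b; apply/forallP=> c; apply/forallP=> d.
apply/implyP=> /and3P[ab bc cd]; apply/negP=> /andP[ac bd].
exact: H ac bd.
Qed.

Lemma noncrossingS T E : T \subset E -> noncrossing E -> noncrossing T.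
Proof.
move=> sTE /noncrossingP nE; apply/noncrossingP=> a b c d ab bc cd ac bd.
exact: nE ab bc cd (adjS sTE ac) (adjS sTE bd).
Qed.

(** * Connectivity above a vertex and active pairs *)

(** The bound is a natural number, not a vertex, so that [a.+1] is meaningful even when [a] is the
    last vertex. *)
Definition adj_ge E (b : nat) : rel V := fun x y => [&& b <= x, b <= y & adj E x y].

Lemma adj_ge_sym E (b : nat) : symmetric (adj_ge E b).
Proof. by move=> x y; rewrite /adj_ge adjC andbCA. Qed.

Lemma connect_geC E (b : nat) x y : connect (adj_ge E b) x y = connect (adj_ge E b) y x.
Proof. exact/sym_connect_sym/adj_ge_sym. Qed.

Lemma connect_geS T E (b b' : nat) x y : T \subset E -> b' <= b ->
  connect (adj_ge T b) x y -> connect (adj_ge E b') x y.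
Proof.
move=> sTE bb'; apply: connect_sub => {}x {}y /and3P[bx by_ xy]; apply: connect1.
by rewrite /adj_ge (leq_trans bb' bx) (leq_trans bb' by_) (adjS sTE).
Qed.

Lemma connect_ge_avoid E (b : nat) v x y : v < b ->
  connect (adj_ge E b) x y -> connect (avoid v (adj E)) x y.
Proof.
move=> vb; apply: connect_sub => {}x {}y /and3P[bx by_ xy]; apply: connect1.
by rewrite /avoid xy andbT; apply/andP; split; apply/eqP=> eq; subst; lia.
Qed.

Lemma path_ge E (b : nat) x p :
  path (adj E) x p -> all (fun y : V => b <= y) (x :: p) -> path (adj_ge E b) x p.
Proof.
elim: p x => //= y p IH x /andP[xy pp] /and3P[bx by_ bp].
by rewrite /adj_ge xy bx by_ IH //= by_.
Qed.

(* If {a,b} is a chord, a path above a from beyond b cannot enter the interval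
   (a,b) before meeting b. *)
Lemma connect_ge_chord E a b v :
  noncrossing E -> adj E a b -> a < b -> b < v ->
  connect (adj_ge E a.+1) v b -> connect (adj_ge E b) v b.
Proof.
move=> /noncrossingP nE ab lab bv /connectP[p].
elim: p v bv => [|z p IH] v bv /=; first by move=> _ eq; subst; lia.
case/andP=> /and3P[av az vz] pp lp.
have [zb|bz|/val_inj zb] := ltngtP z b.
- by case: (nE a z b v az zb bv ab); rewrite adjC.
- apply: connect_trans (IH z bz pp lp); apply: connect1.
  by rewrite /adj_ge vz (ltnW bv) (ltnW bz).
- by subst z; apply: connect1; rewrite /adj_ge vz leqnn (ltnW bv).
Qed.

(** Replace the edges of a path one by one: a detour above the smaller endpoint of an edge is also
    above [b]. *)
Lemma connect_ge_refine E T (b : nat) :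
  (forall x y, b <= x -> x < y -> adj E x y -> connect (adj_ge T x) x y) ->
  forall x y, connect (adj_ge E b) x y -> connect (adj_ge T b) x y.
Proof.
move=> H; apply: connect_sub => x y /and3P[bx by_ xy].
have [lt|lt|/val_inj -> //] := ltngtP x y.
  exact: connect_geS (H x y bx lt xy).
rewrite connect_geC; apply: connect_geS (H y x by_ lt _) => //.
by rewrite adjC.
Qed.

(* In a noncrossing graph containing {a,b}, this says that {a,b} is the
   lexicographically least edge of some cycle. *)
Definition active E a b : bool :=
  (a < b) && [exists y : V, [&& b < y, adj E a y & connect (adj_ge E b) y b]].

Lemma activeP E a b :
  reflect (a < b /\ exists y, [/\ b < y, adj E a y & connect (adj_ge E b) y b])
          (active E a b).
Proof.
apply: (iffP andP) => -[ab H]; split=> //.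
  by case/existsP: H => y /and3P[]; exists y.
by case: H => y [by_ ay yb]; apply/existsP; exists y; apply/and3P.
Qed.

Lemma activeS T E a b : T \subset E -> active T a b -> active E a b.
Proof.
move=> sTE /activeP[ab [y [by_ ay yb]]]; apply/activeP; split=> //.
by exists y; split=> //; [apply: adjS ay | apply: connect_geS yb].
Qed.

Lemma active_connect T a b : active T a b -> connect (adj_ge T a) a b.
Proof.
case/activeP=> ab [y [by_ ay yb]].
apply: (connect_trans (y := y)); last exact: connect_geS (ltnW ab) yb.
by apply: connect1; rewrite /adj_ge leqnn ay andbT /= ltnW // (ltn_trans ab).
Qed.

Definition active_edge E (e : {set V}) : bool :=
  [exists a : V, exists b : V, (e == [set a; b]) && active E a b].

Lemma active_edgeP E e :
  reflect (exists a b, [/\ a < b, e = [set a; b] & active E a b]) (active_edge E e).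
Proof.
apply: (iffP existsP) => [[a /existsP[b /andP[/eqP-> ab]]] | [a [b [_ -> ab]]]].
  by exists a, b; split=> //; case/andP: ab.
by exists a; apply/existsP; exists b; rewrite eqxx.
Qed.

Lemma active_edgeE E a b : a < b -> active_edge E [set a; b] = active E a b.
Proof.
move=> ab; apply/active_edgeP/idP => [[c [d [cd eq act]]] | act].
  by have [-> ->] := pair_lt_inj ab cd eq.
by exists a, b.
Qed.

(** * The core is a noncrossing spanning tree *)

Definition core E : {set {set V}} := [set e in E | ~~ active_edge E e].

Definition chords T : {set {set V}} :=
  [set e | active_edge T e && noncrossing (e |: T)].

Lemma core_sub E : core E \subset E.
Proof. by apply/subsetP=> e; rewrite inE => /andP[]. Qed.

Lemma adj_core E a b : a < b -> adj (core E) a b = adj E a b && ~~ active E a b.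
Proof. by move=> ab; rewrite /adj inE active_edgeE. Qed.

(** Descending lexicographic induction on the edge. An active edge has a detour through a longer
    edge at [x], then through edges whose smaller endpoint exceeds [x]; all of these come later in
    the order. *)
Lemma adj_core_connect E x y :
  x < y -> adj E x y -> connect (adj_ge (core E) x) x y.
Proof.
have [k] := ubnP (n - x); elim: k x y => // k IHk x y nx.
have [l] := ubnP (n - y); elim: l y => // l IHl y ny xy axy.
case act: (active E x y); last first.
  by apply: connect1; rewrite /adj_ge leqnn (ltnW xy) adj_core // axy act.
case/activeP: act => _ [y' [yy' axy' cy]].
have lty' := ltn_ord y'.
apply: connect_trans (IHl y' _ _ axy') _; [lia | lia |].
apply: connect_geS (ltnW xy) _ => //.
apply: connect_ge_refine cy => u w yu uw auw.
by apply: IHk auw => //; lia.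
Qed.

Lemma connect_core E (b : nat) x y :
  connect (adj_ge E b) x y -> connect (adj_ge (core E) b) x y.
Proof. by apply: connect_ge_refine => u w _; apply: adj_core_connect. Qed.

Lemma active_core E a b : active E a b -> active (core E) a b.
Proof.
case/activeP=> ab [y0 [by0 ay0 yb0]].
pose P y := [&& b < y, adj E a y & connect (adj_ge E b) y b].
have Py0 : P y0 by apply/and3P.
(* With [y] maximal, the edge [{a, y}] survives in the core: if it were active, its witness [z > y]
   would also satisfy [P]. *)
case: (arg_maxnP (fun y : V => y : nat) Py0) => y /and3P[by_ ay yb] ymax.
apply/activeP; split=> //; exists y; split=> //; last exact: connect_core.
rewrite adj_core ?ay ?(ltn_trans ab) //=.
apply/negP=> /activeP[_ [z [yz az zy]]].
have /ymax /= : P z.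
  rewrite /P (ltn_trans by_ yz) az /=; apply: connect_trans yb.
  exact: connect_geS (ltnW by_) zy.
by rewrite leqNgt yz.
Qed.

(** By [connect_ge_chord] the path from [c] to [b] can be kept above [b], which makes [{a, b}]
    active in [E], so it would have been deleted. *)
Lemma core_no_cycle E a b c :
  noncrossing E -> a < b -> b < c -> adj (core E) a b -> adj (core E) a c ->
  connect (adj_ge (core E) a.+1) c b -> False.
Proof.
move=> nE ab bc; rewrite adj_core // => /andP[aab /negP nact] aac ccb.
apply: nact; apply/activeP; split=> //; exists c; split=> //.
  exact: adjS (core_sub E) aac.
exact/(connect_ge_chord nE aab ab bc)/(connect_geS (core_sub E) (leqnn _) ccb).
Qed.

Lemma core_acyclic E : noncrossing E -> acyclic (core E).
Proof.
move=> nE; apply/acyclicP=> s; case: s => // v0 s0.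
set s := v0 :: s0 => cs us; rewrite leqNgt; apply/negP=> ss.
have Pv0 : v0 \in s by rewrite inE eqxx.
(* Rotate the cycle to start at its least vertex [a]. Its two neighbours [b] and [c] on the cycle
   are then joined above [a], and the smaller of them contradicts [core_no_cycle]. *)
case: (arg_minnP (fun y : V => y : nat) Pv0) => a as_ amin.
have [k p rk] := rot_to as_.
have cp : cycle (adj (core E)) (a :: p) by rewrite -rk rot_cycle.
have up : uniq (a :: p) by rewrite -rk rot_uniq.
have sp : 2 < size (a :: p) by rewrite -rk size_rot.
have ap x : x \in p -> a < x.
  move=> xp; have /amin /= : x \in s by rewrite -(mem_rot k) rk inE xp orbT.
  rewrite leq_eqVlt => /orP[/eqP/val_inj eq|//].
  by move: up; rewrite /= eq xp.
case: p {rk} cp up sp ap => [|b q] //=.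
rewrite rcons_path => /and3P[aab pq aca] /and3P[_ bq uq] sq ap.
set c := last b q in aca.
have cq : c \in q by rewrite /c; case: (q) sq => //= d r _; exact: mem_last.
have bc : b != c by apply: contraNneq bq => ->.
have con : connect (adj_ge (core E) a.+1) b c.
  by apply/connectP; exists q => //; apply: path_ge => //; apply/allP.
have ab : a < b by apply: ap; rewrite inE eqxx.
have ac : a < c by apply: ap; rewrite inE cq orbT.
rewrite adjC in aca.
have [lt|lt|/val_inj eq] := ltngtP b c; last by rewrite eq eqxx in bc.
  by apply: (core_no_cycle nE ab lt aab aca); rewrite connect_geC.
exact: (core_no_cycle nE ac lt aca aab).
Qed.

Lemma connect_ge0 E x y : connect (adj E) x y = connect (adj_ge E 0) x y.
Proof. exact: eq_connect. Qed.

Lemma core_tree E : connected_noncrossing_graph E -> noncrossing_tree (core E).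
Proof.
case/and3P=> sE nE cE; apply/andP; split; last exact: core_acyclic.
apply/and3P; split.
- apply/forall_inP=> e /(subsetP (core_sub E)); exact: (forall_inP sE).
- exact: noncrossingS (core_sub E) nE.
- apply/forallP=> x; apply/forallP=> y.
  rewrite connect_ge0; apply: connect_core; rewrite -connect_ge0.
  by move/forallP/(_ x)/forallP: cE; apply.
Qed.

Lemma core_complement E : noncrossing E -> E :\: core E \subset chords (core E).
Proof.
move=> nE; apply/subsetP=> e; rewrite !inE => /andP[ne eE].
move: ne; rewrite eE negbK => /active_edgeP[a [b [ab eab act]]].
rewrite eab active_edgeE // active_core //=.
by apply: noncrossingS nE; rewrite -eab subUset sub1set eE core_sub.
Qed.

(** * Graphs with a given core *)

Lemma chords_lt T a b :
  a < b -> [set a; b] \in chords T -> active T a b /\ noncrossing ([set a; b] |: T).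
Proof. by move=> ab; rewrite inE active_edgeE // => /andP[]. Qed.

Lemma adjU T S x y : adj (T :|: S) x y = adj T x y || adj S x y.
Proof. by rewrite /adj inE. Qed.

(** A path between the two neighbours that misses [x] would close up through [x] into a cycle of
    length at least three. *)
Lemma acyclic_bypass T x y z :
  acyclic T -> x != y -> adj T x y -> adj T x z -> y != z ->
  ~~ connect (avoid x (adj T)) y z.
Proof.
move=> /acyclicP aT xy axy axz yz; apply/negP=> /connectP[p0 pp0 lz].
case/shortenP: pp0 lz => p /path_avoid[pp xp] up _ lz.
have := aT (x :: y :: p).
rewrite /= rcons_path axy pp -lz adjC axz => /(_ isT).
rewrite inE negb_or xy xp /= => /(_ up).
by case: p lz {pp xp up} => // lz _; rewrite lz eqxx in yz.
Qed.

Lemma acyclic_not_active T a b : acyclic T -> adj T a b -> ~~ active T a b.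
Proof.
move=> aT aab; apply/negP=> /activeP[ab [y [by_ ay yb]]].
have := acyclic_bypass aT (ord_lt_neq ab) aab ay (ord_lt_neq by_).
by rewrite (connect_ge_avoid ab) // connect_geC.
Qed.

Section Fiber.
Variables T S : {set {set V}}.
Hypotheses (tT : noncrossing_tree T) (sS : S \subset chords T).

Lemma fiber_connect_ge (b : nat) x y :
  connect (adj_ge (T :|: S) b) x y -> connect (adj_ge T b) x y.
Proof.
apply: connect_ge_refine => u w _ uw; rewrite adjU => /orP[Tuw|Suw].
  by apply: connect1; rewrite /adj_ge leqnn (ltnW uw).
by case: (chords_lt uw (subsetP sS _ Suw)) => /active_connect.
Qed.

(** If the witnessing edge [{a, y}] is an added chord, its own activity in [T] yields a tree edge
    [{a, z}] with [z > y], which serves as witness instead. *)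
Lemma fiber_active a b : active (T :|: S) a b -> active T a b.
Proof.
case/activeP=> ab [y [by_ ay /fiber_connect_ge yb]].
have lay := ltn_trans ab by_.
apply/activeP; split=> //; move: ay; rewrite adjU => /orP[ay|Say].
  by exists y.
case: (chords_lt lay (subsetP sS _ Say)) => /activeP[_ [z [yz az zy]]] _.
exists z; split=> //; first exact: ltn_trans yz.
by apply: connect_trans yb; apply: connect_geS (ltnW by_) zy.
Qed.

Lemma fiber_noncrossing : noncrossing (T :|: S).
Proof.
have /andP[/and3P[_ nT _] _] := tT.
apply/noncrossingP=> a b c d ab bc cd; rewrite !adjU.
have ac := ltn_trans ab bc; have bd := ltn_trans bc cd.
have sT e : T \subset e |: T by apply: subsetUr.
have ch e x y : e = [set x; y] -> adj (e |: T) x y.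
  by move=> ->; rewrite /adj setU11.
case/orP=> [Tac|/(subsetP sS)/(chords_lt ac)[_ /noncrossingP nac]].
  case/orP=> [Tbd|/(subsetP sS)/(chords_lt bd)[_ /noncrossingP nbd]].
    exact: (noncrossingP _ nT) Tac Tbd.
  exact: nbd ab bc cd (adjS (sT _) Tac) (ch _ _ _ erefl).
case/orP=> [Tbd|/(subsetP sS)/(chords_lt bd)[/activeP[_ [y [dy by_ _]]] _]].
  exact: nac ab bc cd (ch _ _ _ erefl) (adjS (sT _) Tbd).
(* Both edges are added chords: activity of [{b, d}] gives a tree edge [{b, y}] with [y > d], and
   that edge already crosses [{a, c}]. *)
exact: nac ab bc (ltn_trans cd dy) (ch _ _ _ erefl) (adjS (sT _) by_).
Qed.

Lemma fiber_graph : connected_noncrossing_graph (T :|: S).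
Proof.
have /andP[/and3P[sT nT /forallP cT] _] := tT.
apply/and3P; split; last 2 first.
- exact: fiber_noncrossing.
- apply/forallP=> x; apply/forallP=> y; have /forallP/(_ y) := cT x.
  apply: connect_sub => u w uw; apply: connect1; rewrite adjU uw //.
apply/forall_inP=> e; rewrite inE => /orP[/(forall_inP sT)//|/(subsetP sS)].
rewrite inE => /andP[/active_edgeP[a [b [ab -> _]]] _]; by rewrite cards2 ord_lt_neq.
Qed.

Lemma fiber_disjoint : [disjoint T & S].
Proof.
have /andP[_ aT] := tT.
rewrite disjoints_subset; apply/subsetP=> e eT; rewrite inE; apply/negP.
move/(subsetP sS); rewrite inE => /andP[/active_edgeP[a [b [ab eab act]]] _].
by move: act; apply/negP/acyclic_not_active => //; rewrite /adj -eab.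
Qed.

Lemma core_fiber : core (T :|: S) = T.
Proof.
have /andP[/and3P[sT _ _] aT] := tT.
apply/setP=> e; rewrite inE in_setU; apply/andP/idP => [[/orP[//|eS] /negP[]]|eT].
  move/(subsetP sS): eS; rewrite inE => /andP[/active_edgeP[a [b [ab -> act]]] _].
  by rewrite active_edgeE //; apply: activeS act; apply: subsetUl.
rewrite eT; split=> //; have [a [b [ab eab]]] := simple_graph_edge sT eT.
rewrite eab active_edgeE //; apply/negP=> /fiber_active.
by apply/negP/acyclic_not_active => //; rewrite /adj -eab.
Qed.

End Fiber.

(** * Parents in a noncrossing tree *)

(** Reachability from the root without [j] replaces the position on a root path;
    [on_root_path_parent] shows that the two agree on edges of a tree. *)
Definition is_parent T i j : bool :=
  [&& j != ord0, adj T i j & connect (avoid j (adj T)) ord0 i].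

Definition parent T j : V := odflt ord0 [pick i | is_parent T i j].

Section Tree.
Variable T : {set {set V}}.
Hypothesis tT : noncrossing_tree T.

Let sT : simple_graph T. Proof. by case/andP: tT => /and3P[]. Qed.
Let nT : forall a b c d, a < b -> b < c -> c < d ->
             adj T a c -> adj T b d -> False.
Proof. by apply/noncrossingP; case/andP: tT => /and3P[]. Qed.
Let cT x y : connect (adj T) x y.
Proof. by case/andP: tT => /and3P[_ _ /forallP/(_ x)/forallP]. Qed.
Let aT : acyclic T. Proof. by case/andP: tT. Qed.

Let connect_avoidC v x y :
  connect (avoid v (adj T)) x y = connect (avoid v (adj T)) y x.
Proof. exact/sym_connect_sym/avoid_sym/adjC. Qed.

Lemma is_parent_unique i i' j : is_parent T i j -> is_parent T i' j -> i = i'.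
Proof.
case/and3P=> j0 aij ci /and3P[_ ai'j ci']; apply/eqP/negP=> /negP ii'.
rewrite adjC in aij; rewrite adjC in ai'j.
have /negP[] := acyclic_bypass aT (adj_neq sT aij) aij ai'j ii'.
by apply: connect_trans ci'; rewrite connect_avoidC.
Qed.

Lemma parentP j : j != ord0 -> is_parent T (parent T j) j.
Proof.
move=> j0; rewrite /parent; case: pickP => //= none.
have := connect_last_step (cT ord0 j).
rewrite eq_sym => /(_ j0)[i ci aij].
by have := none i; rewrite /is_parent j0 aij ci.
Qed.

Lemma is_parentE i j : is_parent T i j = (j != ord0) && (i == parent T j).
Proof.
apply/idP/andP => [pij|[j0 /eqP->]]; last exact: parentP.
have j0 : j != ord0 by case/and3P: pij.
by rewrite j0; split=> //; apply/eqP/(is_parent_unique pij)/parentP.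
Qed.

(** A walk from the root to [x] that avoids [y] first enters [x] from some [z] other than [y]. Then
    [z] is a parent of [x], and uniqueness excludes [y]. *)
Lemma is_parent_asym x y : is_parent T x y -> ~~ is_parent T y x.
Proof.
case/and3P=> y0 axy cx; apply/negP=> pyx; have /and3P[x0 _ _] := pyx.
have := connect_last_step cx; rewrite eq_sym => /(_ x0)[z cz /and3P[zy _ azx]].
have pzx : is_parent T z x.
  rewrite /is_parent x0 azx /=; apply: connect_sub cz => u w.
  case/and3P=> ux wx /and3P[_ _ uw]; apply: connect1.
  by rewrite /avoid ux wx.
by rewrite (is_parent_unique pzx pyx) eqxx in zy.
Qed.

Lemma adj_is_parent x y : adj T x y -> is_parent T x y || is_parent T y x.
Proof.
move=> axy; have ayx : adj T y x by rewrite adjC.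
have xy := adj_neq sT axy.
have [y0|y0] := eqVneq y ord0.
  by rewrite /is_parent [x == _]eq_sym -y0 eq_sym xy ayx connect0 !orbT.
case cx: (connect (avoid y (adj T)) ord0 x); first by rewrite /is_parent y0 axy cx.
have x0 : x != ord0 by apply: contraFneq cx => ->; rewrite connect0.
apply/orP; right; rewrite /is_parent x0 ayx /=.
have /and3P[_ aiy ci] := parentP y0; set i := parent T y in aiy ci.
have ix : i != x by apply: contraFneq cx => <-.
apply: (connect_trans (y := i)); last first.
  by apply: connect1; rewrite /avoid ix eq_sym xy.
(* Since [x] is unreachable without [y], the walk from the root to the parent [i] of [y] misses [x];
   the step from [i] to [y] extends it. *)
have := connect_avoid_unreachable ci (negbT cx); apply: connect_sub => u w.
case/and3P=> ux wx /and3P[_ _ uw]; apply: connect1.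
by rewrite /avoid ux wx.
Qed.

(** Each nonroot vertex [j] owns the edge to its parent; asymmetry of parenthood makes this
    assignment injective. *)
Lemma card_tree : #|T| = n.
Proof.
have -> : T = [set [set parent T j; j] | j in [set~ ord0]].
  apply/setP=> e; apply/idP/imsetP => [eT|[j]]; last first.
    by rewrite !inE => /parentP/and3P[_ aj _] ->.
  have [a [b [_ eab]]] := simple_graph_edge sT eT.
  have: adj T a b by rewrite /adj -eab.
  case/adj_is_parent/orP; rewrite is_parentE => /andP[j0 /eqP p].
    by exists b; rewrite ?inE // eab p.
  by exists a; rewrite ?inE // eab p setUC.
rewrite card_in_imset ?cardsC1 ?card_ord // => j j'; rewrite !inE => j0 j'0 eq.
have := set22 (parent T j) j; rewrite eq => /set2P[jp|//].
have := set22 (parent T j') j'; rewrite -eq => /set2P[jp'|//].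
have: is_parent T j j' by rewrite is_parentE j'0 jp eqxx.
by move/is_parent_asym; rewrite is_parentE j0 jp' eqxx.
Qed.

Lemma on_root_path_parent i j : adj T i j -> on_root_path T i j = is_parent T i j.
Proof.
move=> aij; have ij := adj_neq sT aij.
apply/on_root_pathP/idP => [[p [pp up lp ip]]|/and3P[j0 _ /connectP[p0 pp0 li]]].
  case/splitPl: ip pp up lp => p1 p2 li; rewrite cat_path -cat_cons cat_uniq.
  rewrite last_cat li => /andP[pp1 _] /and3P[_ dis _] lj.
  have jp2 : j \in p2.
    move: lj; case: (p2) => [/= eq|y q <- /=]; first by rewrite eq eqxx in ij.
    exact: mem_last.
  have jp1 : j \notin ord0 :: p1.
    by apply: contra dis => jp1; apply/hasP; exists j.
  rewrite /is_parent aij; apply/andP; split.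
    by apply: contraNneq jp1 => ->; rewrite inE eqxx.
  by apply/connectP; exists p1 => //; apply: avoid_path.
case/shortenP: pp0 li => p /path_avoid[pp jp] up _ li.
exists (rcons p j); split.
- by rewrite rcons_path pp -li.
- by rewrite -rcons_cons rcons_uniq up inE negb_or j0 jp.
- by rewrite last_rcons.
- by rewrite -rcons_cons mem_rcons inE li mem_last orbT.
Qed.

(** * Active chords, descents and edge counts *)

Definition descent_bottoms : {set V} := [set j | (j != ord0) && (j < parent T j)].

Lemma card_descents : #|descents T| = #|descent_bottoms|.
Proof.
have -> : descents T = [set (parent T j, j) | j in descent_bottoms].
  apply/setP=> -[i j]; rewrite inE /=; apply/and3P/imsetP.
    case=> aij ji; rewrite on_root_path_parent // is_parentE => /andP[j0 /eqP ip].
    by exists j; rewrite ?ip // inE j0 -ip.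
  case=> j'; rewrite inE => /andP[j0 jp] [-> ->]; have pj := parentP j0.
  have /and3P[_ aj _] := pj.
  by split=> //; rewrite on_root_path_parent.
by rewrite card_in_imset // => j j' _ _ [].
Qed.

Lemma descent_bottom_active j :
  (j \in descent_bottoms) = [exists x, active T x j].
Proof.
rewrite inE; apply/andP/existsP => [[j0 jp]|[x /activeP[xj [y [jy axy yj]]]]].
  have /and3P[_ aij] := parentP j0; set i := parent T j in jp aij *.
  rewrite connect_avoidC => ci0; apply/existsP; apply: contraT => /existsPn nact.
  (* The walk from the parent of [j] to the root starts in [P] and must leave it. The leaving step
     goes from [u > j] to some [w < j], and makes [{w, j}] active. *)
  pose P w := (j < w) && connect (adj_ge T j) w j.
  suff: P ord0 by rewrite /P ltn0.
  apply: (connect_invariant _ ci0); last first.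
    by rewrite /P jp; apply: connect1; rewrite /adj_ge leqnn ltnW.
  move=> u w /and3P[uj wj auw] /andP[ju cuj].
  rewrite /P; have [jw|wj'|/val_inj eq] := ltngtP j w; last by rewrite eq eqxx in wj.
    apply: connect_trans cuj; apply: connect1.
    by rewrite /adj_ge adjC auw (ltnW ju) (ltnW jw).
  case/negP: (nact w); apply/activeP; split=> //; exists u; split=> //.
  by rewrite adjC.
have j0 : j != ord0 by apply/eqP=> eq; subst.
split=> //; have pj := parentP j0; set i := parent T j in pj *.
have yj' : y != j by apply/eqP=> eq; subst; lia.
have [z cz /and3P[jz _ azj]] := connect_last_step yj yj'.
have [//|ij|/val_inj eq] := ltngtP j i; last first.
  by have /and3P[_ aij _] := pj; have := adj_neq sT aij; rewrite -eq eqxx.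
exfalso.
have {}cz : connect (avoid j (adj T)) y z.
  apply: connect_sub cz => u w /and3P[uj wj /and3P[_ _ auw]]; apply: connect1.
  by rewrite /avoid uj wj.
(* If the root reached [y] without [j], then [z] would be the parent of [j], although
   [i < j <= z]. *)
have n0y : ~~ connect (avoid j (adj T)) ord0 y.
  apply/negP=> c0y; have pz : is_parent T z j.
    by rewrite /is_parent j0 azj; apply: connect_trans c0y cz.
  by have := is_parent_unique pj pz => eq; subst z; lia.
have n0x : ~~ connect (avoid j (adj T)) ord0 x.
  apply: contra n0y => c0x; apply: connect_trans c0x (connect1 _).
  rewrite /avoid axy yj' !andbT; apply/eqP=> eq; subst; lia.
have /and3P[_ aij ci] := pj.
have xi : x != i by apply: contraNneq n0x => ->.
have [lt|lt|/val_inj eq] := ltngtP x i; last by rewrite eq eqxx in xi; last first.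
  (* The walk from the root to [i] misses [x] and [y], so to enter the interval between them it
     would have to cross the edge [{x, y}]. *)
  pose P w := connect (avoid j (adj T)) ord0 w && ~~ (x < w < y).
  suff: P i by rewrite /P lt (ltn_trans ij jy) andbF.
  apply: (connect_invariant _ ci); last by rewrite /P connect0 ltn0.
  move=> u w auw /andP[c0u nu]; have c0w := connect_trans c0u (connect1 auw).
  rewrite /P c0w; apply/negP=> /andP[xw wy]; have /and3P[_ _ auw'] := auw.
  have ux : u != x by apply: contraNneq n0x => <-.
  have uy : u != y by apply: contraNneq n0y => <-.
  have [ux'|xu|/val_inj eq] := ltngtP u x; last by rewrite eq eqxx in ux.
    exact: nT ux' xw wy auw' axy.
  have [uy'|yu|/val_inj eq] := ltngtP u y; last by rewrite eq eqxx in uy.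
    by rewrite xu uy' in nu.
  by apply: nT xw wy yu axy _; rewrite adjC.
(* Here [i < x < j < y], so the edges [{i, j}] and [{x, y}] cross. *)
exact: nT lt xj jy aij axy.
Qed.

Lemma active_noncrossing_max x j : active T x j ->
  noncrossing ([set x; j] |: T) = [forall x', active T x' j ==> (x' <= x)].
Proof.
case/activeP=> xj [y [jy axy yj]]; have exj : adj ([set x; j] |: T) x j.
  by rewrite /adj setU11.
have sub : T \subset [set x; j] |: T by apply: subsetUr.
apply/noncrossingP/forallP => [nc x'|mx].
  apply/implyP=> /activeP[x'j [y' [jy' axy' _]]]; rewrite leqNgt; apply/negP=> xx'.
  exact: nc xx' x'j jy' exj (adjS sub axy').
(* By maximality of [x], such a [v] is not joined to [j] above [j]. If [v > y], the edge crosses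
   [{x, y}]; if [v < y], the path from [j] to [y] has to jump over [v] and crosses [{u, v}]. *)
have out u v : x < u -> u < j -> j < v -> adj T u v -> False.
  move=> xu uj jv auv.
  have ncv : ~~ connect (adj_ge T j) v j.
    apply/negP=> cvj; have := mx u; rewrite leqNgt xu implybF => /negP[].
    by apply/activeP; split=> //; exists v.
  have [yv|vy|/val_inj eq] := ltngtP y v; last by rewrite -eq yj in ncv.
    exact: nT xu (ltn_trans uj jy) yv axy auv.
  pose P w := connect (adj_ge T j) w j && (w < v).
  suff: P y by rewrite /P ltnNge (ltnW vy) andbF.
  rewrite connect_geC in yj.
  apply: (connect_invariant _ yj); last by rewrite /P connect0.
  move=> s w asw /andP[csj sv].
  have cwj : connect (adj_ge T j) w j.
    by apply: connect_trans csj; apply: connect1; rewrite adj_ge_sym.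
  rewrite /P cwj /=; have /and3P[js jw asw'] := asw.
  have [//|vw|/val_inj eq] := ltngtP w v; last by rewrite -eq cwj in ncv.
  by case: (nT (leq_trans uj js) sv vw auv asw').
move=> a b c d ab bc cd; rewrite /adj !in_setU1.
have ac := ltn_trans ab bc; have bd := ltn_trans bc cd.
case/orP=> [/eqP/(pair_lt_inj ac xj)[? ?]|aac].
  case/orP=> [/eqP/(pair_lt_inj bd xj)[? ?]|abd]; first by subst; lia.
  by subst; apply: out abd.
case/orP=> [/eqP/(pair_lt_inj bd xj)[? ?]|abd]; last exact: nT aac abd.
(* A tree edge that crosses [{x, j}] from below [x] also crosses the tree edge [{x, y}]. *)
by subst; apply: nT ab bc (ltn_trans cd jy) aac axy.
Qed.

Definition chord_end j : V :=
  odflt ord0 [pick x | active T x j && [forall x', active T x' j ==> (x' <= x)]].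

Lemma chord_endP j : j \in descent_bottoms ->
  active T (chord_end j) j /\ noncrossing ([set chord_end j; j] |: T).
Proof.
rewrite descent_bottom_active => /existsP[x0 ax0]; rewrite /chord_end.
case: pickP => [x /andP[ax mx]|none] /=; first by rewrite active_noncrossing_max.
case: (@arg_maxnP _ x0 (fun x => active T x j) (fun x : V => x : nat) ax0) => x ax mx.
have /negP[] := negbT (none x); rewrite ax; apply/forallP=> x'.
by apply/implyP; apply: mx.
Qed.

Lemma card_chords : #|chords T| = #|descents T|.
Proof.
rewrite card_descents.
have -> : chords T = [set [set chord_end j; j] | j in descent_bottoms].
  apply/setP=> e; apply/idP/imsetP => [|[j jD ->]]; last first.
    have [act nc] := chord_endP jD; rewrite inE nc andbT active_edgeE //.
    by case/activeP: act.
  rewrite inE => /andP[/active_edgeP[a [j [aj -> act]]] nc].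
  have jD : j \in descent_bottoms.
    by rewrite descent_bottom_active; apply/existsP; exists a.
  exists j => //; have [act' nc'] := chord_endP jD.
  rewrite active_noncrossing_max // in nc.
  rewrite active_noncrossing_max // in nc'.
  move/forallP/(_ (chord_end j)): nc; rewrite act' /= => le1.
  move/forallP/(_ a): nc'; rewrite act /= => le2.
  by congr [set _; _]; apply/val_inj/eqP; rewrite eqn_leq le1 le2.
rewrite card_in_imset // => j j' /chord_endP[/activeP[lt _] _].
by move=> /chord_endP[/activeP[lt' _] _] /(pair_lt_inj lt lt')[].
Qed.

(** Neither the root nor the last vertex lies below its parent in the order, which leaves [n - 1]
    candidates. *)
Lemma card_descents_lt : 0 < n -> #|descents T| < n.
Proof.
move=> n0; rewrite card_descents.
have mx : (ord_max : V) \in [set~ ord0] by rewrite !inE -val_eqE /= -lt0n.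
have := cardsD1 ord_max [set~ ord0 : V]; rewrite mx cardsC1 card_ord /= add1n.
move=> cn; rewrite [X in _ < X]cn ltnS.
apply: subset_leq_card; apply/subsetP=> j.
rewrite !inE => /andP[-> jp]; rewrite andbT; apply: contraTneq jp => ->.
by rewrite -leqNgt -ltnS.
Qed.

End Tree.

(** The core has [n] edges, and the deleted ones are among at most [n - 1] chords. Hence the range
    of summation over [m] captures every graph. *)
Lemma card_connected_noncrossing_graph E :
  0 < n -> connected_noncrossing_graph E -> n <= #|E| < 2 * n.
Proof.
move=> n0 gE; have tE := core_tree gE; have /and3P[_ nE _] := gE.
have := subset_leq_card (core_complement nE).
have := card_descents_lt tE n0.
rewrite card_chords // cardsD (setIidPr (core_sub E)) (card_tree tE).
have := subset_leq_card (core_sub E); rewrite (card_tree tE); lia.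
Qed.

End Graphs.

Import GRing.Theory.
Local Open Scope ring_scope.

(** * Binomial sums *)

Lemma sum_subsets (U : finType) (A : {set U}) (F : nat -> int) :
  \sum_(S : {set U} | S \subset A) F #|S| =
  \sum_(s < #|A|.+1) F s *+ 'C(#|A|, s).
Proof.
have lt (S : {set U}) : S \subset A -> (#|S| < #|A|.+1)%N.
  by move=> /subset_leq_card.
rewrite (partition_big (fun S : {set U} => inord #|S| : 'I_#|A|.+1) predT) //=.
apply: eq_bigr => s _; rewrite -cards_draws -sumr_const.
apply: congr_big => // [S|S /andP[/lt Slt /eqP <-]]; last by rewrite inordK.
rewrite !inE; case sSA: (S \subset A) => //=.
by rewrite -val_eqE /= inordK // lt.
Qed.

Lemma coef_1DXn (s k : nat) : ((1 + 'X) ^+ s : {poly int})`_k = ('C(s, k))%:Z.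
Proof.
elim: s k => [|s IH] k; first by rewrite expr0 coef1 bin0n; case: k.
rewrite exprS mulrDl mul1r coefD coefXM !IH.
by case: k => [|k] /=; rewrite ?addr0 ?bin0 // binS PoszD.
Qed.

(* Compare coefficients of 'X^k in the expansion of (1 - (1 + 'X)) ^+ d. *)
Lemma sum_sign_bin (d k : nat) :
  \sum_(s < d.+1) ((-1) ^+ s * ('C(s, k))%:Z) *+ 'C(d, s) =
  (-1) ^+ k *+ (d == k) :> int.
Proof.
have signE (s : nat) : (-1) ^+ s = ((-1) ^+ s)%:P :> {poly int}.
  by rewrite polyC_exp polyCN.
transitivity (((- 'X) ^+ d : {poly int})`_k); last first.
  rewrite (exprNn 'X) signE coefCM coefXn eq_sym.
  by case: eqVneq => [->|_]; rewrite ?mulr1 ?mulr0.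
have -> : - 'X = 1 - (1 + 'X) :> {poly int} by rewrite opprD addNKr.
rewrite exprDn coef_sum; apply: eq_bigr => s _.
by rewrite coefMn expr1n mul1r (exprNn (1 + 'X)) signE coefCM coef_1DXn.
Qed.

(** * Summation over the fibers of the core map *)

Lemma sum_connected_noncrossing_graphs (n : nat) (F : nat -> int) :
  \sum_(E : {set {set 'I_n.+1}} | connected_noncrossing_graph E) F #|E| =
  \sum_(T : {set {set 'I_n.+1}} | noncrossing_tree T)
     \sum_(s < #|descents T|.+1) F (n + s)%N *+ 'C(#|descents T|, s).
Proof.
rewrite (partition_big (@core n) (@noncrossing_tree n)) /=; last exact: core_tree.
apply: eq_bigr => T tT; rewrite -card_chords // -(sum_subsets (chords T) (fun s => F (n + s)%N)).
(* A graph with core [T] is determined by its set of further edges, which ranges over all subsets of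
   [chords T]. *)
rewrite (reindex_onto (fun S => T :|: S) (fun E => E :\: T)) /=; last first.
  move=> E /andP[_ /eqP <-]; rewrite -[RHS](setID E (core E)).
  by rewrite (setIidPr (core_sub E)).
have fiberE S : (connected_noncrossing_graph (T :|: S) && (core (T :|: S) == T)
    && ((T :|: S) :\: T == S)) = (S \subset chords T).
  apply/andP/idP => [[/andP[/and3P[_ nE _] /eqP cE] /eqP <-]|sS].
    by have := core_complement nE; rewrite cE.
  rewrite fiber_graph // core_fiber // eqxx; split=> //.
  rewrite setDUl setDv set0U; apply/eqP/setDidPl.
  by rewrite disjoint_sym fiber_disjoint.
apply: eq_big => [S|S]; rewrite fiberE // => sS.
by rewrite cardsU disjoint_setI0 ?fiber_disjoint // cards0 subn0 card_tree.
Qed.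

Unset Implicit Arguments.

Theorem theorem3p1 (n k : nat) (hn : (1 <= n)%N) :
  \sum_(n <= m < 2 * n)
     (-1) ^+ (m - n) * ('C(m - n, k))%:Z
       * (nb_connected_noncrossing_graphs n m)%:Z
  = (-1) ^+ k * (nb_noncrossing_trees_descents n k)%:Z.
Proof.
pose G m : int := (-1) ^+ (m - n) * ('C(m - n, k))%:Z.
transitivity (\sum_(E | connected_noncrossing_graph (n := n) E) G #|E|).
  transitivity (\sum_(n <= m < 2 * n)
      \sum_(E | connected_noncrossing_graph (n := n) E && (#|E| == m)) G m).
    apply: eq_bigr => m _.
    rewrite -/(G m) -[(_ _ m)%:Z]natz mulr_natr -sumr_const.
    by apply: eq_bigl => E; rewrite inE.
  rewrite (exchange_big_dep (@connected_noncrossing_graph n)) /=; last first.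
    by move=> m E _ /andP[].
  apply: eq_bigr => E gE; rewrite gE /=.
  (* For a fixed graph only [m = #|E|] contributes, and it lies in the range. *)
  under eq_bigl => m do rewrite eq_sym.
  by rewrite big_nat1_eq card_connected_noncrossing_graph.
rewrite sum_connected_noncrossing_graphs.
under eq_bigr => T _.
  under eq_bigr => s _ do rewrite /G addKn.
  rewrite sum_sign_bin mulrb; over.
(* Only the trees with exactly [k] descents remain, each with weight [(-1) ^+ k]. *)
rewrite -big_mkcondr -[(_ _ k)%:Z]natz mulr_natr -sumr_const.
by apply: eq_bigl => T; rewrite inE.
Qed.
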